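(* Let $R$ be a commutative ring, let $\mathfrak{U} \subseteq R^\times$ be a subgroup, and let $V$ be a $VIC^{\mathfrak{U}}(R)$-module over $\mathbb{C}$ whose degree of generation and injectivity degree are both $\le k$. Then there exists a $VIC(R)$-module $\hat V$ over $\mathbb{C}$ which restricts to $V$ in degrees $> k$; that is, for all $n > k$ the vector space $\hat V_n$ is $V_n$, the action of $GL_n(R)$ on $\hat V_n$ restricted to $SL_n^{\mathfrak{U}}(R)$ is the given action on $V_n$, and the structure maps $\hat V_n \to \hat V_{n+1}$ are the given maps $V_n \to V_{n+1}$.
   Context: $SL_n^{\mathfrak{U}}(R)$ is the group of $n\times n$ matrices over $R$ with determinant in $\mathfrak{U}$. A $VIC^{\mathfrak{U}}(R)$-module over $\mathbb{C}$ is a sequence of complex vector spaces $V_3,V_4,V_5,\dots$ such that: (1) each $V_n$ is a representation of $SL_n^{\mathfrak{U}}(R)$; (2) for each $n$ there is given a linear map $V_n \to V_{n+1}$ which is $SL_n^{\mathfrak{U}}(R)$-equivariant for the standard (top left corner) inclusion $SL_n^{\mathfrak{U}}(R) \subset SL_{n+1}^{\mathfrak{U}}(R)$; (3) for all $n,m$ the complementary (bottom right corner) copy of $SL_m^{\mathfrak{U}}(R)$ in $SL_{n+m}^{\mathfrak{U}}(R)$ acts trivially on the image of $V_n$ in $V_{n+m}$. A $VIC(R)$-module is the same thing with $\mathfrak{U}=R^\times$, i.e. with $GL_n(R)$ in place of $SL_n^{\mathfrak{U}}(R)$ (equivalently, a functor from the category of free $R$-modules of finite rank $\ge 3$ with split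 injections to vector spaces). The degree of generation is $\le k$ if for every $n > k$ the representation $V_n$ is generated, as an $SL_n^{\mathfrak{U}}(R)$-representation, by the image of $V_{n-1}$ (equivalently $V$ is generated by its terms in degrees $\le k$). The injectivity degree is $\le k$ if the maps $V_n \to V_{n+1}$ are injective for all $n \ge k$. *)

(* Defs.v *)
From mathcomp Require Import all_boot all_algebra.
From mathcomp Require Import classical_sets reals.
From mathcomp Require Import complex.

Set Implicit Arguments.
Unset Strict Implicit.
Unset Printing Implicit Defensive.

Import GRing.Theory.
Local Open Scope ring_scope.
Local Open Scope classical_set_scope.

(* [R] may be the zero ring, so the library's [GRing.unit], which needs a
   nontrivial ring, is not available. *)
Definition units (R : comPzRingType) : set R :=
  [set a | exists b, a * b = 1].
Arguments units R : clear implicits.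

Record unit_subgroup (R : comPzRingType) (U : set R) : Prop := UnitSubgroup {
  unit_subgroup_sub : U `<=` units R;
  unit_subgroup1 : U 1;
  unit_subgroupM : forall a b, U a -> U b -> U (a * b);
  unit_subgroupV : forall a b, U a -> a * b = 1 -> U b
}.

(* [SL (units R) n] is GL_n(R). *)
Definition SL (R : comPzRingType) (U : set R) (n : nat) : set 'M[R]_n :=
  [set A | U (\det A)].

(* Sizes are written [m + n] rather than [n + m], so that [1 + n] is
   convertible to [n.+1]; the blocks of size [n] still come first. *)
Definition upper_left (R : comPzRingType) (n m : nat) (A : 'M[R]_n) :
    'M[R]_(m + n) :=
  castmx (addnC n m, addnC n m) (block_mx A 0 0 1%:M).

Definition lower_right (R : comPzRingType) (n m : nat) (B : 'M[R]_m) :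
    'M[R]_(m + n) :=
  castmx (addnC n m, addnC n m) (block_mx 1%:M 0 0 B).

Fixpoint iter_map (C : pzRingType) (V : nat -> lmodType C)
    (phi : forall n, {linear V n -> V n.+1}) (n m : nat) : V n -> V (m + n)%N :=
  match m with
  | 0 => id
  | p.+1 => fun x => phi (p + n)%N (iter_map phi p x)
  end.

(* Only the degrees [n >= 3] and, in degree [n], only the operators [act A]
   with [A] in [SL U n] are part of the mathematical object: all other values
   are junk, on which neither the axioms below nor the later definitions
   depend. *)
Record VIC_module (K : realType) (R : comPzRingType) (U : set R) :=
    VICModule {
  space :> nat -> lmodType K[i];
  act : forall n, 'M[R]_n -> space n -> space n;
  smap : forall n, {linear space n -> space n.+1};
  act_linear : forall n (A : 'M[R]_n), (3 <= n)%N -> SL U A ->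
    linear (act A);
  act1 : forall n (x : space n), (3 <= n)%N -> act 1%:M x = x;
  actM : forall n (A B : 'M[R]_n) (x : space n), (3 <= n)%N ->
    SL U A -> SL U B -> act (A *m B) x = act A (act B x);
  smap_equivariant : forall n (A : 'M[R]_n) (x : space n), (3 <= n)%N ->
    SL U A -> smap n (act A x) = @act n.+1 (upper_left 1 A) (smap n x);
  smap_stable : forall n m (B : 'M[R]_m) (x : space n), (3 <= n)%N ->
    SL U B ->
    act (lower_right n B) (iter_map smap m x) = iter_map smap m x
}.

Section Degrees.
Variables (K : realType) (R : comPzRingType) (U : set R).
Variable V : VIC_module K U.

Definition subrepresentation (n : nat) (S : set (V n)) : Prop :=
  [/\ S 0,
      forall (a : K[i]) (x y : V n), S x -> S y -> S (a *: x + y) &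
      forall (A : 'M[R]_n) (x : V n), SL U A -> S x -> S (act A x)].

Definition generated_by (n : nat) (X : set (V n)) : Prop :=
  forall S : set (V n), subrepresentation S -> X `<=` S -> S = setT.

(* The image of V_{n-1} in V_n. A module has no term in degree 2, so this is
   empty for [n = 3]. *)
Definition image_of_pred (n : nat) : set (V n) :=
  match n return set (V n) with
  | 0 => set0
  | p.+1 => [set x | (3 <= p)%N /\ exists y : V p, x = smap V p y]
  end.

Definition generation_degree_le (k : nat) : Prop :=
  forall n, (3 <= n)%N -> (k < n)%N -> generated_by (@image_of_pred n).

Definition injectivity_degree_le (k : nat) : Prop :=
  forall n, (3 <= n)%N -> (k <= n)%N -> injective (smap V n).

End Degrees.

Definition cast_space (C : pzRingType) (V W : lmodType C) (e : V = W) (x : V) :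
    W :=
  ecast T (T : lmodType C) e x.

(* The spaces are literally equal in degrees [n > k], and the casts along these
   equalities identify the actions of [SL U n] and the structure maps. *)
Definition restricts_to (K : realType) (R : comPzRingType) (U : set R)
    (k : nat) (W : VIC_module K (units R)) (V : VIC_module K U) : Prop :=
  exists e : forall n, (3 <= n)%N -> (k < n)%N -> W n = V n,
    (forall n (h3 : (3 <= n)%N) (hk : (k < n)%N) (A : 'M[R]_n) (x : W n),
       SL U A ->
       cast_space (e n h3 hk) (act A x) = act A (cast_space (e n h3 hk) x)) /\
    (forall n (h3 : (3 <= n)%N) (hk : (k < n)%N) (x : W n),
       cast_space (e n.+1 (leqW h3) (leqW hk)) (smap W n x) =
       smap V n (cast_space (e n h3 hk) x)).

(* Main.v *)
Require Import Defs.
From mathcomp Require Import all_boot all_algebra.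
From mathcomp Require Import classical_sets reals.
From mathcomp Require Import complex.
From mathcomp Require Import zify.

(** The action of GL_n on V_n is read off one degree higher.  For A in GL_n of
    determinant a, the matrix diag(A, a^-1) of size n+1 has determinant 1, so it
    acts on V_{n+1}; for n > k the structure map f : V_n -> V_{n+1} is injective,
    and A is made to act on V_n by the restriction of diag(A, a^-1) to the
    image of f.

    Everything rests on the bottom right blocks acting trivially on images.

    - The image of f is stable under diag(A, a^-1) ([has_lift_gl]).  The x such
      that every diag(A, a^-1) sends f x into the image of f form a
      subrepresentation of V_n, so by the bound on the degree of generation it
      is enough to treat x = f v with v in V_{n-1}.  Put
      A' = A diag(1, .., 1, a^-1), of determinant 1.  Since
      diag(1, .., 1, a^-1, a) fixes f (f v), the matrix diag(A, a^-1) acts on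
      this vector as diag(A', 1) does, and the result is f (A' (f v)).
    - If a lies in U, then diag(A, a^-1) and diag(A, 1) differ by the block
      a^-1, which fixes the image of f: the new action extends the given one
      ([gl_act_SL]).
    - The structure maps are equivariant because diag(A, a^-1, 1) and
      diag(A, 1, a^-1) differ by diag(1, a^-1, a), which fixes the image of V_n
      in V_{n+2} ([gl_act_equivariant]).
    - A block B of GL_m fixes the image of V_n in V_{n+m} because
      diag(B, det(B)^-1) fixes the image of V_n in V_{n+m+1}
      ([gl_act_stable]).

    In the degrees n <= k nothing is required, and the extended module is taken
    to be zero there. *)

Set Implicit Arguments.
Unset Strict Implicit.
Unset Printing Implicit Defensive.

Import GRing.Theory.
Local Open Scope ring_scope.
Local Open Scope classical_set_scope.

(** * Block diagonal matrices *)

Section BlockDiagonal.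
Variable R : comPzRingType.

(** This is the common form of [upper_left] and [lower_right], which are
    convertible to [diag_block A 1%:M] and [diag_block 1%:M B]; hence the order
    of the summands in the size. *)
Definition diag_block n m (A : 'M[R]_n) (B : 'M[R]_m) : 'M[R]_(m + n) :=
  castmx (addnC n m, addnC n m) (block_mx A 0 0 B).

Lemma det_castmx n n' (e : n = n') (A : 'M[R]_n) :
  \det (castmx (e, e) A) = \det A.
Proof. by case: n' / e; rewrite castmx_id. Qed.

Lemma det_diag_block n m (A : 'M[R]_n) (B : 'M[R]_m) :
  \det (diag_block A B) = \det A * \det B.
Proof. by rewrite det_castmx det_ublock. Qed.

Lemma mul_castmx n n' (e : n = n') (A B : 'M[R]_n) :
  castmx (e, e) A *m castmx (e, e) B = castmx (e, e) (A *m B).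
Proof. by case: n' / e; rewrite !castmx_id. Qed.

Lemma mul_diag_block n m (A A' : 'M[R]_n) (B B' : 'M[R]_m) :
  diag_block A B *m diag_block A' B' = diag_block (A *m A') (B *m B').
Proof.
by rewrite mul_castmx mulmx_block !mulmx0 !mul0mx !addr0 !add0r.
Qed.

Lemma diag_blockE n m (A : 'M[R]_n) (B : 'M[R]_m) (i j : 'I_(m + n)) :
  diag_block A B i j =
  match split (cast_ord (addnC m n) i), split (cast_ord (addnC m n) j) with
  | inl i', inl j' => A i' j'
  | inr i', inr j' => B i' j'
  | _, _ => 0
  end.
Proof.
rewrite castmxE !mxE /=.
rewrite (_ : cast_ord _ i = cast_ord (addnC m n) i); last exact: val_inj.
rewrite (_ : cast_ord _ j = cast_ord (addnC m n) j); last exact: val_inj.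
by case: split => i'; rewrite !mxE; case: split => j'; rewrite ?mxE.
Qed.

(** The last block has size 1, so that both sides have convertible sizes. *)
Lemma diag_blockA n m (A : 'M[R]_n) (B : 'M[R]_m) (C : 'M[R]_1) :
  diag_block (diag_block A B) C =
  diag_block A (diag_block B C) :> 'M[R]_(1 + (m + n)).
Proof.
(* The two sides have convertible but not syntactically equal sizes; giving
   each side its own indices lets arithmetic relate them. *)
suff entry (i j : 'I_(1 + (m + n))) (i' j' : 'I_(1 + m + n)) :
    i = i' :> nat -> j = j' :> nat ->
    diag_block (diag_block A B) C i j = diag_block A (diag_block B C) i' j'.
  by apply/matrixP => i j; apply: entry.
move=> ei ej; rewrite !diag_blockE.
do 4!case: splitP => -[? ?] /= ?; rewrite ?diag_blockE;
  do ?[case: splitP => -[? ?] /= ?];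
  (by []) || lia || (f_equal; apply: ord_inj => /=; lia).
Qed.

End BlockDiagonal.

Section Border.
Variable R : comPzRingType.

(** [border A (\det A)^-1] is the lift of A to determinant 1. *)
Definition border n (A : 'M[R]_n) (b : R) : 'M[R]_(1 + n) :=
  diag_block A (b%:M : 'M[R]_1).

Lemma det_border n (A : 'M[R]_n) b : \det (border A b) = \det A * b.
Proof. by rewrite det_diag_block det_scalar1. Qed.

Lemma mul_border n (A B : 'M[R]_n) b c :
  border A b *m border B c = border (A *m B) (b * c).
Proof. by rewrite mul_diag_block -scalar_mxM. Qed.

Lemma border_diag_block n m (A : 'M[R]_n) (B : 'M[R]_m) c :
  border (diag_block A B) c = diag_block A (border B c).
Proof. exact: diag_blockA. Qed.

Lemma border_border n (A : 'M[R]_n) b c :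
  border (border A b) c = diag_block A (border (b%:M : 'M_1) c).
Proof. exact: diag_blockA. Qed.

Lemma upper_left_border n (A : 'M[R]_n) : upper_left 1 A = border A 1.
Proof. by []. Qed.

Lemma inverse_unique (a b c : R) : a * b = 1 -> a * c = 1 -> b = c.
Proof. by move=> ab ac; rewrite -[b]mulr1 -ac mulrA [b * a]mulrC ab mul1r. Qed.

End Border.

(** * The action of GL_n *)

Lemma linear_0 (C : pzRingType) (M N : lmodType C) (f : M -> N) :
  linear f -> f 0 = 0.
Proof.
by move=> lf; have := lf (-1) 0 0; rewrite !scaleN1r oppr0 addr0 addNr.
Qed.

Section GLAction.
Variables (K : realType) (R : comPzRingType) (U : set R).
Hypothesis hU : unit_subgroup U.
Variables (V : VIC_module K U) (k : nat).
Hypothesis hgen : generation_degree_le V k.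
Hypothesis hinj : injectivity_degree_le V k.

Lemma SL_det1 n (A : 'M[R]_n) : \det A = 1 -> SL U A.
Proof. by move=> A1; rewrite /SL /= A1; exact: unit_subgroup1 hU. Qed.

Lemma SL_border_inv n (A : 'M[R]_n) b : \det A * b = 1 -> SL U (border A b).
Proof. by move=> Ab; apply: SL_det1; rewrite det_border. Qed.

Lemma SL_border1 n (A : 'M[R]_n) : SL U A -> SL U (border A 1).
Proof. by rewrite /SL /= det_border mulr1. Qed.

Lemma act0 n (A : 'M[R]_n) : (3 <= n)%N -> SL U A -> act A (0 : V n) = 0.
Proof. by move=> n3 hA; exact/linear_0/act_linear. Qed.

(** The two ways in which the triviality of the bottom right block is used: a
    block of size 1 with entry in U, and a block diag(b, c) with b c in U. *)
Lemma act_border_smap n (c : R) (x : V n) : (3 <= n)%N -> U c ->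
  act (border 1%:M c) (smap V n x) = smap V n x.
Proof.
by move=> n3 Uc; apply: (smap_stable (m := 1)) => //; rewrite /SL /= det_scalar1.
Qed.

Lemma act_border_smap_smap n (b c : R) (x : V n) : (3 <= n)%N -> U (b * c) ->
  act (border (border 1%:M b) c) (smap V n.+1 (smap V n x)) =
  smap V n.+1 (smap V n x).
Proof.
move=> n3 Ubc; rewrite border_border.
apply: (@smap_stable _ _ _ V n 2) => //.
by rewrite /SL /= det_border det_scalar1.
Qed.

(** In the degrees where the structure map is injective there is at most one
    such y, and it is the value at x of the new action of A.  Quantifying over b
    names the inverse of \det A without choosing it; for A outside GL_n every y
    is a lift. *)
Definition is_lift n (A : 'M[R]_n) (x y : V n) : Prop :=
  forall b, \det A * b = 1 -> smap V n y = act (border A b) (smap V n x).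

Lemma is_liftI n (A : 'M[R]_n) (x y : V n) b : \det A * b = 1 ->
  smap V n y = act (border A b) (smap V n x) -> is_lift A x y.
Proof. by move=> Ab e c Ac; rewrite (inverse_unique Ac Ab). Qed.

Definition gl_liftable n : set (V n) :=
  [set x | forall A, units R (\det A) -> exists y, is_lift A x y].

(** Stability under g in SL^U_n holds because diag(A, b) diag(g, 1) is, up to
    a last block with entry in U, the lift of A g. *)
Lemma gl_liftable_sub n : (3 <= n)%N -> subrepresentation (@gl_liftable n).
Proof.
move=> n3; have n3' := leqW n3; split.
- move=> A _; exists 0 => b Ab.
  by rewrite linear0 act0 //; exact: SL_border_inv.
- move=> a x y hx hy A hA.
  have [[x' ex] [y' ey]] := (hx A hA, hy A hA).
  exists (a *: x' + y') => b Ab.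
  rewrite !linearP (ex b Ab) (ey b Ab) act_linear //; exact: SL_border_inv.
- move=> g x hg hx A [b Ab].
  have [u gu] := unit_subgroup_sub hU hg.
  have Uu : U u := unit_subgroupV hU hg gu.
  have Agbu : \det (A *m g) * (b * u) = 1.
    by rewrite det_mulmx mulrACA Ab gu mulr1.
  have [|y hy] := hx (A *m g); first by exists (b * u).
  exists y; apply: (is_liftI Ab).
  have ey := hy _ Agbu.
  (* diag(Ag, b) and diag(Ag, b det(g)^-1) differ by the last block det(g),
     which lies in U and so fixes the image of the structure map. *)
  rewrite smap_equivariant // upper_left_border -actM //; last first.
  + exact: SL_border1.
  + exact: SL_border_inv.
  rewrite mul_border mulr1 -(act_border_smap y n3 hg) ey -actM //; last first.
  + exact: SL_border_inv.
  + by rewrite /SL /= det_border det1 mul1r.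
  by rewrite mul_border mul1mx mulrCA gu mulr1.
Qed.

(** For x = f v, the factor diag(1, .., 1, b) moves \det A from A to the last
    2 x 2 block, which fixes f x; the rest of the matrix lies in SL_n.  For n = 3
    there is no such v, and the argument is vacuous. *)
Lemma image_of_pred_liftable n : @image_of_pred _ _ _ V n `<=` @gl_liftable n.
Proof.
case: n => // p x [p3 [v ->]] A [b Ab].
have p3' := leqW p3; have p3'' := leqW p3'.
have SA' : SL U (A *m border 1%:M b).
  by apply: SL_det1; rewrite det_mulmx det_border det1 mul1r.
exists (act (A *m border 1%:M b) (smap V p v)).
apply: (is_liftI Ab).
rewrite smap_equivariant // upper_left_border.
rewrite -[in RHS](@act_border_smap_smap p b (\det A)) //; last first.
  by rewrite mulrC Ab; exact: unit_subgroup1 hU.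
rewrite -actM //.
- by rewrite mul_border [b * _]mulrC Ab.
- exact: SL_border_inv.
- by apply: SL_det1; rewrite !det_border det1 mul1r mulrC.
Qed.

(** This is where the bound on the degree of generation enters. *)
Lemma has_lift_gl n (A : 'M[R]_n) (x : V n) : (3 <= n)%N -> (k < n)%N ->
  units R (\det A) -> exists y, is_lift A x y.
Proof.
move=> n3 kn hA.
have liftT := hgen n3 kn (gl_liftable_sub n3) (@image_of_pred_liftable n).
have : gl_liftable x by rewrite liftT.
exact.
Qed.

Definition gl_act n (A : 'M[R]_n) (x : V n) : V n := xget 0 (is_lift A x).

Lemma smap_gl_act n (A : 'M[R]_n) (x : V n) b : (3 <= n)%N -> (k < n)%N ->
  \det A * b = 1 -> smap V n (gl_act A x) = act (border A b) (smap V n x).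
Proof.
move=> n3 kn Ab; have hA : units R (\det A) by exists b.
exact: (xgetPex 0 (has_lift_gl x n3 kn hA)) b Ab.
Qed.

Lemma gl_act_linear n (A : 'M[R]_n) : (3 <= n)%N -> (k < n)%N ->
  SL (units R) A -> linear (@gl_act n A).
Proof.
move=> n3 kn [b Ab] a x y; apply: (hinj n3 (ltnW kn)).
rewrite linearP !(smap_gl_act _ n3 kn Ab) linearP act_linear //.
- exact: leqW.
- exact: SL_border_inv.
Qed.

(** For A in SL^U_n the border b lies in U, so it can be changed to 1, and then
    the equivariance of the structure map applies. *)
Lemma gl_act_SL n (A : 'M[R]_n) (x : V n) : (3 <= n)%N -> (k < n)%N ->
  SL U A -> gl_act A x = act A x.
Proof.
move=> n3 kn hA; have n3' := leqW n3.
have [b Ab] := unit_subgroup_sub hU hA.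
have Ub : U b := unit_subgroupV hU hA Ab.
apply: (hinj n3 (ltnW kn)).
rewrite (smap_gl_act _ n3 kn Ab) smap_equivariant // upper_left_border.
rewrite -[in RHS](act_border_smap x n3 Ub) -actM //.
- by rewrite mul_border mulmx1 mul1r.
- exact: SL_border1.
- by rewrite /SL /= det_border det1 mul1r.
Qed.

Lemma gl_actM n (A B : 'M[R]_n) (x : V n) : (3 <= n)%N -> (k < n)%N ->
  SL (units R) A -> SL (units R) B ->
  gl_act (A *m B) x = gl_act A (gl_act B x).
Proof.
move=> n3 kn [a Aa] [b Bb]; apply: (hinj n3 (ltnW kn)).
have ABab : \det (A *m B) * (a * b) = 1.
  by rewrite det_mulmx mulrACA Aa Bb mulr1.
rewrite (smap_gl_act _ n3 kn ABab) (smap_gl_act _ n3 kn Aa).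
rewrite (smap_gl_act _ n3 kn Bb) -mul_border actM //.
- exact: leqW.
- exact: SL_border_inv.
- exact: SL_border_inv.
Qed.

(** After one more structure map, both sides are values of lifts of A to
    degree n + 2 that differ by the block diag(b, \det A) of determinant 1. *)
Lemma gl_act_equivariant n (A : 'M[R]_n) (x : V n) : (3 <= n)%N -> (k < n)%N ->
  SL (units R) A ->
  smap V n (gl_act A x) = @gl_act n.+1 (upper_left 1 A) (smap V n x).
Proof.
move=> n3 kn [b Ab]; have n3' := leqW n3; have kn' := leqW kn.
have n3'' := leqW n3'.
have Ab' : \det (upper_left 1 A) * b = 1.
  by rewrite upper_left_border det_border mulr1.
apply: (hinj n3' (ltnW kn')).
rewrite (smap_gl_act _ n3' kn' Ab') (smap_gl_act _ n3 kn Ab).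
rewrite smap_equivariant //; last exact: SL_border_inv.
rewrite !upper_left_border.
rewrite -[in RHS](@act_border_smap_smap n b (\det A)) //; last first.
  by rewrite mulrC Ab; exact: unit_subgroup1 hU.
rewrite -actM //.
- by rewrite !mul_border mulmx1 mul1r [b * _]mulrC Ab.
- exact: SL_border_inv.
- by apply: SL_det1; rewrite !det_border det1 mul1r mulrC.
Qed.

(** Bordering B by the inverse of its determinant gives a bottom right block
    of size m + 1 and determinant 1, to which the stability of V applies one
    degree higher. *)
Lemma gl_act_stable n m (B : 'M[R]_m) (x : V n) : (3 <= n)%N -> (k < n)%N ->
  SL (units R) B ->
  gl_act (lower_right n B) (iter_map (smap V) m x) = iter_map (smap V) m x.
Proof.
move=> n3 kn [b Bb].
have n3' : (3 <= m + n)%N := leq_trans n3 (leq_addl _ _).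
have kn' : (k < m + n)%N := leq_trans kn (leq_addl _ _).
have Bb' : \det (lower_right n B) * b = 1.
  by rewrite [\det _]det_diag_block det1 mul1r.
apply: (hinj n3' (ltnW kn')); rewrite (smap_gl_act _ n3' kn' Bb').
rewrite [border _ _]border_diag_block.
apply: (@smap_stable _ _ _ V n m.+1) => //.
exact: SL_border_inv.
Qed.

End GLAction.

(** * Truncation to the degrees above k *)

Section ZeroUnless.
Variables (C : pzRingType) (T : lmodType C).

Definition zero_unless (b : bool) : lmodType C :=
  if b then T else 'rV[C]_0.

(** Mutually inverse when b holds; zero otherwise.  Conjugating by these maps
    transfers a structure from T to [zero_unless b] without any cast. *)
Definition to_base b : {linear zero_unless b -> T} :=
  match b with true => idfun | false => \0%R end.

Definition of_base b : {linear T -> zero_unless b} :=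
  match b with true => idfun | false => \0%R end.

Lemma of_baseK (b : bool) : b -> cancel (of_base b) (to_base b).
Proof. by case: b. Qed.

Lemma to_baseK b : cancel (to_base b) (of_base b).
Proof. by case: b => x //=; rewrite [x]thinmx0. Qed.

Lemma zero_unlessP b (x : zero_unless b) : ~~ b -> x = 0.
Proof. by case: b x => // x _; apply: thinmx0. Qed.

Definition zero_unless_eq (b : bool) : b -> zero_unless b = T :=
  match b with true => fun=> erefl | false => fun h => ltac:(by []) end.

Lemma cast_zero_unless (b : bool) (h : b) (x : zero_unless b) :
  cast_space (zero_unless_eq h) x = to_base b x.
Proof. by case: b h x. Qed.

End ZeroUnless.

Section Extension.
Variables (K : realType) (R : comPzRingType) (U : set R).
Hypothesis hU : unit_subgroup U.
Variables (V : VIC_module K U) (k : nat).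
Hypothesis hgen : generation_degree_le V k.
Hypothesis hinj : injectivity_degree_le V k.

Definition large n := (3 <= n)%N && (k < n)%N.

Definition ext n : lmodType K[i] := zero_unless (V n) (large n).

Definition ext_act n (A : 'M[R]_n) (x : ext n) : ext n :=
  of_base (V n) (large n) (gl_act A (to_base _ _ x)).

Definition ext_smap n : {linear ext n -> ext n.+1} :=
  of_base (V n.+1) (large n.+1) \o (smap V n \o to_base (V n) (large n)).

Lemma large_addl n m : large n -> large (m + n).
Proof.
by move=> /andP[n3 kn]; rewrite /large !(leq_trans _ (leq_addl m n)).
Qed.

Lemma ext_small n (x y : ext n) : (3 <= n)%N -> ~~ (k < n)%N -> x = y.
Proof.
move=> n3 kn; have nl : ~~ large n by rewrite /large n3.
by rewrite (zero_unlessP x nl) (zero_unlessP y nl).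
Qed.

Lemma to_base_act n (A : 'M[R]_n) (x : ext n) : large n ->
  to_base (V n) _ (ext_act A x) = gl_act A (to_base _ _ x).
Proof. by move=> ln; rewrite /ext_act (of_baseK ln). Qed.

Lemma to_base_smap n (x : ext n) : large n ->
  to_base (V n.+1) _ (ext_smap n x) = smap V n (to_base _ _ x).
Proof. by move=> /(large_addl 1) ln; rewrite /= (of_baseK ln). Qed.

Lemma to_base_iter n m (x : ext n) : large n ->
  to_base (V (m + n)%N) _ (iter_map ext_smap m x) =
  iter_map (smap V) m (to_base _ _ x).
Proof.
move=> ln; elim: m => [//|m IH].
rewrite [iter_map _ _ _ in RHS]/= -IH -to_base_smap //.
exact: large_addl.
Qed.

Lemma iter_ext0 n m : iter_map ext_smap m (0 : ext n) = 0.
Proof. by elim: m => //= m ->; rewrite !linear0. Qed.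

Lemma ext_act_linear n (A : 'M[R]_n) : (3 <= n)%N -> SL (units R) A ->
  linear (@ext_act n A).
Proof.
move=> n3 hA a x y; have [kn|kn] := boolP (k < n)%N; last exact: ext_small.
by rewrite /ext_act linearP (gl_act_linear hU hgen hinj) // linearP.
Qed.

Lemma ext_act0 n (A : 'M[R]_n) : (3 <= n)%N -> SL (units R) A ->
  ext_act A 0 = 0.
Proof. by move=> n3 hA; exact/linear_0/ext_act_linear. Qed.

Lemma ext_act1 n (x : ext n) : (3 <= n)%N -> ext_act 1%:M x = x.
Proof.
move=> n3; have [kn|kn] := boolP (k < n)%N; last exact: ext_small.
have S1 : SL U (1%:M : 'M[R]_n) by rewrite /SL /= det1; exact: unit_subgroup1 hU.
by rewrite /ext_act (gl_act_SL hU hgen hinj) // act1 // to_baseK.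
Qed.

Lemma ext_actM n (A B : 'M[R]_n) (x : ext n) : (3 <= n)%N ->
  SL (units R) A -> SL (units R) B ->
  ext_act (A *m B) x = ext_act A (ext_act B x).
Proof.
move=> n3 hA hB; have [kn|kn] := boolP (k < n)%N; last exact: ext_small.
have ln : large n by rewrite /large n3.
by rewrite {1 2}/ext_act to_base_act // (gl_actM hU hgen hinj).
Qed.

Lemma ext_smap_equivariant n (A : 'M[R]_n) (x : ext n) : (3 <= n)%N ->
  SL (units R) A ->
  ext_smap n (ext_act A x) = @ext_act n.+1 (upper_left 1 A) (ext_smap n x).
Proof.
move=> n3 hA; have n3' := leqW n3.
have [kn|kn] := boolP (k < n)%N.
  have ln : large n by rewrite /large n3.
  have ln' : large n.+1 := large_addl 1 ln.
  apply: (can_inj (@to_baseK _ _ _)).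
  rewrite to_base_smap // to_base_act // (gl_act_equivariant hU hgen hinj) //.
  by rewrite (to_base_act (n := n.+1)) // to_base_smap.
have -> : x = 0 by exact: ext_small.
rewrite ext_act0 // linear0 ext_act0 //.
by case: hA => b Ab; exists b; rewrite upper_left_border det_border mulr1.
Qed.

(** A bottom right copy of GL_m may act in a large degree while n is small; the
    image to be fixed is then zero. *)
Lemma ext_smap_stable n m (B : 'M[R]_m) (x : ext n) : (3 <= n)%N ->
  SL (units R) B ->
  ext_act (lower_right n B) (iter_map ext_smap m x) = iter_map ext_smap m x.
Proof.
move=> n3 hB; have [kn|kn] := boolP (k < n)%N.
  have ln : large n by rewrite /large n3.
  have lmn : large (m + n) := large_addl m ln.
  apply: (can_inj (@to_baseK _ _ _)).
  by rewrite to_base_act // to_base_iter // (gl_act_stable hU hgen hinj).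
have -> : x = 0 by exact: ext_small.
rewrite iter_ext0 ext_act0 //; first exact: leq_trans n3 (leq_addl _ _).
by rewrite /SL /= [\det _]det_diag_block det1 mul1r.
Qed.

Definition extension : VIC_module K (units R) :=
  VICModule ext_act_linear ext_act1 ext_actM ext_smap_equivariant
    ext_smap_stable.

Lemma extension_restricts : restricts_to k extension V.
Proof.
pose e n (n3 : (3 <= n)%N) (kn : (k < n)%N) :=
  zero_unless_eq (V n) (introT andP (conj n3 kn) : large n).
exists e; split=> [n n3 kn A x hA|n n3 kn x].
  rewrite !cast_zero_unless to_base_act ?(gl_act_SL hU hgen hinj) //.
  by rewrite /large n3.
by rewrite !cast_zero_unless to_base_smap // /large n3.
Qed.

End Extension.

Theorem theorem3p10 (K : realType) (R : comPzRingType) (U : set R)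
    (hU : unit_subgroup U) (V : VIC_module K U) (k : nat)
    (hgen : generation_degree_le V k) (hinj : injectivity_degree_le V k) :
  exists W : VIC_module K (units R), restricts_to k W V.
Proof. by exists (extension hU hgen hinj); exact: extension_restricts. Qed.
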